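(* Let $\mathbf{Y}$ be a finite non-empty set. In the double agnostic testing protocol described in the context, Sceptic has a strategy (a rule choosing his moves $f^{\mathrm{I}}_n,f^{\mathrm{II}}_n$ at each step $n$ as a function of the forecasters' moves made before his move) which keeps both capitals non-negative, $\mathcal{K}^{\mathrm{I}}_n\ge 0$ and $\mathcal{K}^{\mathrm{II}}_n\ge 0$ for all $n$, and which guarantees that, whatever moves Forecaster I and Forecaster II make, $\|P^{\mathrm{I}}_n-P^{\mathrm{II}}_n\|\to 0$ as $n\to\infty$ whenever the following three conditions are all satisfied: \begin{itemize} \item $P^{\mathrm{I}}_n-P^{\mathrm{II}}_n\to 0$ weakly as $n\to\infty$, i.e., $P^{\mathrm{I}}_n([x])-P^{\mathrm{II}}_n([x])\to 0$ as $n\to\infty$ for every $x\in\mathbf{Y}^*$; \item it is not the case that $\mathcal{K}^{\mathrm{I}}_n\to\infty$ as $n\to\infty$; \item it is not the case that $\mathcal{K}^{\mathrm{II}}_n\to\infty$ as $n\to\infty$. \end{itemize}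
   Context: $\mathbf{Y}$ is a finite non-empty set (the observation space) with the discrete $\sigma$-algebra. $\mathbf{Y}^*$ is the set of all finite sequences of elements of $\mathbf{Y}$ (including the empty one), $\mathbf{Y}^+$ is the set of all non-empty finite sequences, and for $x\in\mathbf{Y}^*$, $[x]\subseteq\mathbf{Y}^\infty$ is the set of all infinite sequences having $x$ as a prefix. $\mathfrak{P}(\mathbf{Y}^\infty)$ is the set of all probability measures on $\mathbf{Y}^\infty$ with its Borel $\sigma$-algebra (product topology). For $P,Q\in\mathfrak{P}(\mathbf{Y}^\infty)$, the total variation distance is $\|P-Q\|:=2\sup_E|P(E)-Q(E)|\in[0,2]$, with $E$ ranging over Borel subsets of $\mathbf{Y}^\infty$. Double agnostic testing protocol (a perfect-information game; the players move in the stated order and see all previous moves). Start with $\mathcal{K}^{\mathrm{I}}_0=\mathcal{K}^{\mathrm{II}}_0:=1$. For $n=1,2,\dots$: \begin{enumerate} \item Forecaster I announces $P^{\mathrm{I}}_n\in\mathfrak{P}(\mathbf{Y}^\infty)$. \item Forecaster II announces $P^{\mathrm{II}}_n\in\mathfrak{P}(\mathbf{Y}^\infty)$. \item If $n>1$, the capitals are updated by $$\mathcal{K}^{\mathrm{I}}_{n-1}:=\mathcal{K}^{\mathrm{I}}_{n-2}+\sum_{x\in\mathbf{Y}^+}f^{\mathrm{I}}_{n-1}(x)\bigl(P^{\mathrm{I}}_n([x])-P^{\mathrm{I}}_{n-1}([x])\bigr),$$ $$\mathcal{K}^{\mathrm{II}}_{n-1}:=\mathcal{K}^{\mathrm{II}}_{n-2}+\sum_{x\in\mathbf{Y}^+}f^{\mathrm{II}}_{n-1}(x)\bigl(P^{\mathrm{II}}_n([x])-P^{\mathrm{II}}_{n-1}([x])\bigr).$$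 \item Sceptic announces functions $f^{\mathrm{I}}_n,f^{\mathrm{II}}_n:\mathbf{Y}^+\to\mathbb{R}$ such that $f^{\mathrm{I}}_n(x)=f^{\mathrm{II}}_n(x)=0$ for all but finitely many $x\in\mathbf{Y}^+$. \end{enumerate} Here $P^{\mathrm{I}}_n$ and $P^{\mathrm{II}}_n$ are forecasts for the whole sequence of observations $(y_1,y_2,\dots)$, which need never be disclosed. No relation is assumed between the forecasts at different steps. Sceptic is never allowed to go into debt: if a capital becomes negative, his attempt fails. *)

(* Defs.v *)
From HB Require Import structures.
From mathcomp Require Import all_boot all_order all_algebra finmap.
From mathcomp Require Import all_classical all_reals all_analysis.

Set Implicit Arguments.
Unset Strict Implicit.
Unset Printing Implicit Defensive.

Import Order.TTheory GRing.Theory Num.Theory.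
Import numFieldNormedType.Exports.

Local Open Scope classical_set_scope.
Local Open Scope ring_scope.

Definition outcome (Y : Type) : Type :=
  prod_topology (fun _ : nat => discrete_topology Y).

HB.instance Definition _ (Y : pointedType) := Pointed.on (outcome Y).
HB.instance Definition _ (Y : pointedType) := Nbhs.on (outcome Y).
HB.instance Definition _ (Y : pointedType) := Topological.on (outcome Y).

Definition outcome_borel (Y : pointedType) :=
  g_sigma_algebraType (@open (outcome Y)).

Definition forecast (R : realType) (Y : pointedType) : Type :=
  probability (outcome_borel Y) R.

Definition prob (R : realType) (Y : pointedType) (P : forecast R Y)
  (E : set (outcome_borel Y)) : R := fine (P E).

(* The set [x] of the infinite sequences having x as a prefix. *)
Definition cylinder (Y : pointedType) (x : seq Y) : set (outcome_borel Y) :=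
  [set w | mkseq w (size x) = x].

Definition tv_dist (R : realType) (Y : pointedType) (P Q : forecast R Y) : R :=
  2 * sup [set `|prob P E - prob Q E| | E in
             [set E : set (outcome_borel Y) | measurable E]].

Definition nonempty_seq (Y : pointedType) : Type := {x : seq Y | x != [::]}.

(* One of the two functions of a move of Sceptic: Y^+ -> R, zero for all but
   finitely many arguments. *)
Definition portfolio (R : realType) (Y : pointedType) : Type :=
  {fsfun nonempty_seq Y -> R with 0}.

(* The sum over Y^+ is taken over the finite support of f. *)
Definition gain (R : realType) (Y : pointedType) (f : portfolio R Y)
    (P P' : forecast R Y) : R :=
  \sum_(x <- finsupp f)
    f x * (prob P' (cylinder (val x)) - prob P (cylinder (val x))).

(* Sceptic's move as a function of the list, in chronological order, of the
   pairs of forecasts announced so far. *)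
Definition strategy (R : realType) (Y : pointedType) : Type :=
  seq (forecast R Y * forecast R Y) -> portfolio R Y * portfolio R Y.

(* The steps are numbered from 0 here and from 1 in the protocol: [P1 n] and
   [P2 n] are the forecasts of step n + 1, and [move S P1 P2 n] is Sceptic's
   reply to the forecasts of the steps 1, ..., n + 1. Capitals keep the indices
   of the protocol. *)
Definition move (R : realType) (Y : pointedType) (S : strategy R Y)
    (P1 P2 : nat -> forecast R Y) (n : nat) : portfolio R Y * portfolio R Y :=
  S (mkseq (fun i => (P1 i, P2 i)) n.+1).

Fixpoint capital1 (R : realType) (Y : pointedType) (S : strategy R Y)
    (P1 P2 : nat -> forecast R Y) (n : nat) : R :=
  if n is m.+1 then
    capital1 S P1 P2 m + gain (move S P1 P2 m).1 (P1 m) (P1 m.+1)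
  else 1.

Fixpoint capital2 (R : realType) (Y : pointedType) (S : strategy R Y)
    (P1 P2 : nat -> forecast R Y) (n : nat) : R :=
  if n is m.+1 then
    capital2 S P1 P2 m + gain (move S P1 P2 m).2 (P2 m) (P2 m.+1)
  else 1.

Definition merge_weakly (R : realType) (Y : pointedType)
    (P1 P2 : nat -> forecast R Y) : Prop :=
  forall x : seq Y,
    prob (P1 n) (cylinder x) - prob (P2 n) (cylinder x) @[n --> \oo] --> (0 : R).

(* Main.v *)
(** A single fund with threshold [e] proceeds in rounds. A round is opened when
    some finite union [A] of cylinders satisfies [P1 A - P2 A >= e]; from then on
    Sceptic stakes the fraction [e / 4] of his wealth against [A] with Forecaster
    I and on [A] with Forecaster II, and he closes the round once
    [P1 A - P2 A <= e / 2], which weak merging guarantees to happen. The product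
    of the two wealths then has grown by a factor of at least
    [1 + (e / 4) ^+ 2]. At the end of a round, a wealth of at least [2] has [1]
    put aside for ever. Since the wealths never exceed [2], infinitely many rounds
    force infinitely many savings on one of the sides, whose capital then tends
    to infinity, and not merely along a subsequence.
    If there are only finitely many rounds, then eventually
    [P1 A - P2 A < e] for all finite unions [A] of cylinders; as these
    approximate all Borel sets, the total variation distance is eventually at
    most [4 * e]. Sceptic mixes the funds with thresholds [1 / (k + 1)]. *)
Require Import Defs.
From HB Require Import structures.
From mathcomp Require Import all_boot all_order all_algebra finmap.
From mathcomp Require Import all_classical all_reals all_analysis.
From mathcomp Require Import lra ring zify.

Set Implicit Arguments.
Unset Strict Implicit.
Unset Printing Implicit Defensive.

Import Order.TTheory GRing.Theory Num.Theory.
Import numFieldNormedType.Exports.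

Local Open Scope classical_set_scope.
Local Open Scope ring_scope.

(** * Cylinders as a base of the topology, and approximation of Borel sets *)

Lemma mkseq_prefix (T : Type) (f g : nat -> T) (m n : nat) :
  (m <= n)%N -> mkseq f n = mkseq g n -> mkseq f m = mkseq g m.
Proof.
move=> mn /(congr1 (take m)); rewrite -!map_take take_iota.
by have /minn_idPl -> := mn.
Qed.

Section cylindrical.
Context {Y : pointedType}.
Implicit Types (w : outcome_borel Y) (E F : set (outcome_borel Y)).

Lemma mem_cylinder w n : cylinder (mkseq w n) w.
Proof. by rewrite /cylinder /= size_mkseq. Qed.

Lemma nbhs_cylinder (w : outcome Y) (n : nat) :
  nbhs w (cylinder (mkseq w n)).
Proof.
rewrite /cylinder size_mkseq; elim: n => [|n IH].
  by apply: filterS filterT.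
have wn : nbhs w [set v : outcome Y | v n = w n].
  have := @proj_continuous nat (fun=> discrete_topology Y) n w [set w n].
  by apply; exact: discrete_set1.
by move: IH wn; apply: filterS2 => v /= vn vw; rewrite !mkseqS vn vw.
Qed.

(** Otherwise some points [g n] outside [U] share their first [n] letters with [w]; they converge to
    [w] in every coordinate, hence in the product topology, so they must enter [U]. *)
Lemma nbhs_sub_cylinder (w : outcome Y) (U : set (outcome Y)) :
  nbhs w U -> exists n, cylinder (mkseq w n) `<=` U.
Proof.
move=> wU; apply: contrapT => /forallNP noU.
have /choice[g gP] : forall n, exists v : outcome Y,
    cylinder (mkseq w n) v /\ ~ U v.
  by move=> n; have /existsNP[v /not_implyP] := noU n; exists v.
have gw : g @ \oo --> w.
  apply/cvg_sup => N V [W [[Z oZ <-] ZwN ZV]].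
  apply: (filterS ZV); rewrite nbhs_simpl; exists N.+1 => // i /= Ni.
  have [+ _] := gP i; rewrite /cylinder /= size_mkseq => /(mkseq_prefix Ni).
  by rewrite !mkseqS => /eqP; rewrite eqseq_rcons => /andP[_ /eqP->].
have [n _ /(_ n (leqnn n)) /= Ugn] := gw _ wU.
by have [_] := gP n.
Qed.

(** As [B] is an arbitrary set of words, the class is closed under complements and finite unions.
    For finite [Y] its members are the finite unions of cylinders. *)
Definition cylindrical F :=
  exists n (B : set (seq Y)), F = [set w | B (mkseq w n)].

Lemma cylindrical_open F : cylindrical F -> open (F : set (outcome Y)).
Proof.
move=> [n [B ->]]; rewrite openE => w Bw.
apply: filterS (nbhs_cylinder w n) => v.
by rewrite /cylinder /= size_mkseq => ->.
Qed.

Lemma measurable_cylindrical F : cylindrical F -> measurable F.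
Proof.
move=> /cylindrical_open oF.
by apply: (@sub_sigma_algebra _ setT (@open (outcome Y))); exact oF.
Qed.

Lemma cylindrical_cylinder (x : seq Y) : cylindrical (cylinder x).
Proof. exists (size x), [set x]. reflexivity. Qed.

Lemma measurable_cylinder (x : seq Y) : measurable (cylinder x).
Proof. by apply: measurable_cylindrical; exact: cylindrical_cylinder. Qed.

Lemma cylindricalC F : cylindrical F -> cylindrical (~` F).
Proof. by move=> [n [B ->]]; exists n, (~` B). Qed.

Lemma cylindricalU E F :
  cylindrical E -> cylindrical F -> cylindrical (E `|` F).
Proof.
move=> [m [B ->]] [n [C ->]].
exists (maxn m n), [set x | B (take m x) \/ C (take n x)].
apply/seteqP; split => w; rewrite /= /mkseq -!map_take !take_iota;
  by rewrite (minn_idPl (leq_maxl _ _)) (minn_idPl (leq_maxr _ _)).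
Qed.

Context {R : realType} (mu : {measure set (outcome_borel Y) -> \bar R}).
Hypothesis mu_fin : (mu setT < +oo)%E.

Definition approximable E := measurable E /\
  forall e : R, 0 < e -> exists2 F, cylindrical F &
    (mu ((E `\` F) `|` (F `\` E)) < e%:E)%E.

Lemma approximable_cylindrical F : cylindrical F -> approximable F.
Proof.
move=> cF; split; first exact: measurable_cylindrical.
by move=> e e0; exists F => //; rewrite setDv setU0 measure0 lte_fin.
Qed.

Lemma approximableC E : approximable E -> approximable (~` E).
Proof.
move=> [mE aE]; split; first exact: measurableC.
move=> e /aE[F cF EF]; exists (~` F); first exact: cylindricalC.
by rewrite !setDE !setCK setUC (setIC (~` F)) (setIC (~` E)) -!setDE.
Qed.

Let mu_bound (A B C : set (outcome_borel Y)) (a b : R) :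
  measurable A -> measurable B -> measurable C ->
  A `<=` B `|` C -> (mu B < a%:E)%E -> (mu C < b%:E)%E -> (mu A < (a + b)%:E)%E.
Proof.
move=> mA mB mC ABC Ba Cb.
have mBC : measurable (B `|` C) by exact: measurableU.
apply: (@le_lt_trans _ _ (mu (B `|` C))).
  by apply: le_measure; rewrite ?inE.
apply: (@le_lt_trans _ _ (mu B + mu C)%E); first exact: measureU2.
by rewrite EFinD; exact: lteD.
Qed.

Let measurable_symD (A B : set (outcome_borel Y)) :
  measurable A -> measurable B -> measurable ((A `\` B) `|` (B `\` A)).
Proof. by move=> mA mB; apply: measurableU; exact: measurableD. Qed.

Lemma approximableU E1 E2 :
  approximable E1 -> approximable E2 -> approximable (E1 `|` E2).
Proof.
move=> [mE1 aE1] [mE2 aE2]; split; first exact: measurableU.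
move=> e e0; have e20 : 0 < e / 2 by rewrite divr_gt0.
have [F1 cF1 EF1] := aE1 _ e20; have [F2 cF2 EF2] := aE2 _ e20.
have cF := cylindricalU cF1 cF2; exists (F1 `|` F2) => //.
have [mF1 mF2] := (measurable_cylindrical cF1, measurable_cylindrical cF2).
rewrite (splitr e); apply: mu_bound EF1 EF2.
- by apply: measurable_symD; exact: measurableU.
- exact: measurable_symD.
- exact: measurable_symD.
- move=> w /=; have [] := (pselect (E1 w), pselect (E2 w)); tauto.
Qed.

(** The finite unions [B n] exhaust the countable one, so by continuity from above the remainder has
    measure below [e / 2] for some [n]; another [e / 2] is spent on approximating [B n]. *)
Lemma approximable_bigcup (E : (set (outcome_borel Y))^nat) :
  (forall n, approximable (E n)) -> approximable (\bigcup_n E n).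
Proof.
move=> aE; have mE n := (aE n).1.
have mU : measurable (\bigcup_n E n) by exact: bigcup_measurable.
split => // e e0; have e20 : 0 < e / 2 by rewrite divr_gt0.
pose B n := \big[setU/set0]_(i < n) E i.
have aB n : approximable (B n).
  rewrite /B; elim: n => [|n IH].
    rewrite big_ord0; apply: approximable_cylindrical.
    by exists 0%N, set0.
  by rewrite big_ord_recr /=; exact: approximableU.
have mD n : measurable (\bigcup_n E n `\` B n).
  by apply: measurableD => //; case: (aB n).
have : mu \o (fun n => \bigcup_n E n `\` B n) @ \oo -->
    mu (\bigcap_n (\bigcup_n E n `\` B n)).
  apply: nonincreasing_cvg_mu => //.
  - apply: le_lt_trans mu_fin; apply: le_measure; rewrite ?inE //.
  - exact: bigcap_measurable.
  - move=> m n mn; apply/subsetPset; apply: setDS.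
    by apply: subset_bigsetU; exact mn.
have -> : \bigcap_n (\bigcup_n E n `\` B n) = set0.
  apply/seteqP; split => // w H; have [[m _ Emw] _] := H 0%N I.
  have [_] := H m.+1 I; apply.
  by rewrite /B -bigcup_mkord; exists m => /=.
rewrite measure0 => /fine_cvgP[_ /cvgr0Pnorm_lt /(_ _ e20)].
move=> [n _ /(_ n (leqnn n)) /= Dn].
have {}Dn : (mu (\bigcup_n E n `\` B n) < (e / 2)%:E)%E.
  rewrite -[mu _]fineK ?ge0_fin_numE //.
    by rewrite lte_fin; apply: le_lt_trans Dn; exact: ler_norm.
  by apply: le_lt_trans mu_fin; apply: le_measure; rewrite ?inE.
have [F cF BF] := (aB n).2 _ e20.
have mF := measurable_cylindrical cF; exists F => //.
rewrite (splitr e); apply: mu_bound Dn BF.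
- exact: measurable_symD.
- exact: (mD n).
- by apply: measurable_symD => //; case: (aB n).
- have BE : B n `<=` \bigcup_n E n.
    by rewrite /B -bigcup_mkord; exact: bigcup_subset.
  move=> w /=; have := BE w.
  have [] := (pselect ((\bigcup_n E n) w), pselect (B n w)); tauto.
Qed.

(** The points whose first [n] letters already force membership in [U] form a cylindrical set, and
    [U] is the union of these sets over [n]. *)
Lemma approximable_open (U : set (outcome Y)) : open U -> approximable U.
Proof.
move=> oU.
have -> : U = \bigcup_n [set w | cylinder (mkseq w n) `<=` U].
  apply/seteqP; split => w.
    move=> Uw; have [n nU] : exists n, cylinder (mkseq w n) `<=` U.
      by apply: nbhs_sub_cylinder; rewrite openE in oU; exact: oU.
    by exists n.
  by move=> [n _]; apply; exact: mem_cylinder.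
apply: approximable_bigcup => n; apply: approximable_cylindrical.
by exists n, [set x | cylinder x `<=` U].
Qed.

(** The approximable sets form a sigma-algebra containing the open sets. *)
Lemma approximable_measurable E : measurable E -> approximable E.
Proof.
apply: smallest_sub; last by move=> U; exact: approximable_open.
split.
- by apply: approximable_cylindrical; exists 0%N, set0.
- by move=> A aA; rewrite setTD; exact: approximableC.
- exact: approximable_bigcup.
Qed.

End cylindrical.

(** * Prices of finite sets of words, and total variation *)

Section price.
Context {R : realType} {Y : pointedType}.
Implicit Types (P Q : forecast R Y) (A : {fset nonempty_seq Y}).

Lemma probE P (E : set (outcome_borel Y)) : measurable E -> P E = (prob P E)%:E.
Proof. by move=> mE; rewrite /prob fineK // fin_num_measure. Qed.

Lemma prob_ge0 P (E : set (outcome_borel Y)) : 0 <= prob P E.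
Proof. by rewrite /prob fine_ge0. Qed.

Lemma prob_le1 P (E : set (outcome_borel Y)) : measurable E -> prob P E <= 1.
Proof. by move=> mE; rewrite -lee_fin -probE // probability_le1. Qed.

Lemma probC P (E : set (outcome_borel Y)) :
  measurable E -> prob P (~` E) = 1 - prob P E.
Proof.
move=> mE; apply: EFin_inj; rewrite -probE; last exact: measurableC.
by rewrite probability_setC // probE.
Qed.

Lemma prob_sub_symD P (E F : set (outcome_borel Y)) (e : R) :
  measurable E -> measurable F ->
  (P ((E `\` F) `|` (F `\` E)) < e%:E)%E -> prob P E <= prob P F + e.
Proof.
move=> mE mF De.
have mD : measurable ((E `\` F) `|` (F `\` E)).
  by apply: measurableU; exact: measurableD.
rewrite -lee_fin EFinD -!probE //.
apply: (@le_trans _ _ (P (F `|` ((E `\` F) `|` (F `\` E))))).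
  apply: le_measure; rewrite ?inE //; first exact: measurableU.
  by move=> w /=; have := pselect (F w); tauto.
apply: (le_trans (measureU2 _ _ _)) => //.
by apply: leeD => //; exact: ltW.
Qed.

Definition price P A : R := \sum_(x <- A) prob P (cylinder (val x)).

Lemma price0 P : price P fset0 = 0.
Proof. by rewrite /price big_seq_fset0. Qed.

(** Distinct words of equal length have disjoint cylinders, which turns a price into the probability
    of a union and bounds it by 1. *)
Definition same_length A := exists n, forall x, x \in A -> size (val x) = n.

Lemma price_same_length P A : same_length A ->
  price P A = prob P (\bigcup_(x in [set` A]) cylinder (val x)).
Proof.
move=> [n An]; rewrite /price /prob measure_fin_bigcup //.
- rewrite fsbig_finite //= set_fsetK sum_fine //.
  by move=> x _; rewrite fin_num_measure //; exact: measurable_cylinder.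
- move=> x y /= /An xn /An yn [w [xw yw]]; apply: val_inj.
  by move: xw yw; rewrite /cylinder /= xn yn => -> ->.
- by move=> x _; exact: measurable_cylinder.
Qed.

Lemma price_ge0 P A : 0 <= price P A.
Proof. by apply: sumr_ge0 => x _; exact: prob_ge0. Qed.

Lemma price_le1 P A : same_length A -> price P A <= 1.
Proof.
move=> slA; rewrite price_same_length //; apply: prob_le1.
apply: fin_bigcup_measurable => // x _; exact: measurable_cylinder.
Qed.

Hypothesis finY : finite_set [set: Y].

Lemma finite_seq_size (n : nat) : finite_set [set x : seq Y | size x = n].
Proof.
elim: n => [|n IH].
  by apply: sub_finite_set (finite_set1 [::]) => x /size0nil.
have := finite_image2 cons finY IH; apply: sub_finite_set => -[//|y x] /= [xn].
by exists y => //; exists x.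
Qed.

(* The words are taken one letter longer than necessary, since those of a
   portfolio have to be nonempty. *)
Lemma cylindrical_price (F : set (outcome_borel Y)) : cylindrical F ->
  exists2 A, same_length A & forall P, price P A = prob P F.
Proof.
move=> [n [B ->]].
pose W := [set x : nonempty_seq Y | size (val x) = n.+1 /\ B (take n (val x))].
have finW : finite_set W.
  have : finite_set
      (val @^-1` [set x : seq Y | size x = n.+1] : set (nonempty_seq Y)).
    apply: finite_preimage; last exact: finite_seq_size.
    by move=> ? ? _ _; exact: val_inj.
  by apply: sub_finite_set => x [].
have slW : same_length (fset_set W).
  by exists n.+1 => x; rewrite in_fset_set // inE => -[].
exists (fset_set W) => // P; rewrite price_same_length // fset_setK //.
congr (prob P _); apply/seteqP; split=> w /=.
  move=> [x [xn Bx]]; rewrite /cylinder /= xn => wx; move: Bx.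
  by rewrite -(wx : _ = val x) /mkseq -map_take take_iota
    (minn_idPl (leqnSn n)).
move=> Bw; have ne : mkseq w n.+1 != [::] by [].
exists (exist (fun x : seq Y => x != [::]) _ ne); last exact: mem_cylinder.
split; rewrite [val _]/= ?size_mkseq //.
by rewrite /mkseq -map_take take_iota (minn_idPl (leqnSn n)).
Qed.

Lemma tv_dist_ge0 P Q : 0 <= tv_dist P Q.
Proof.
rewrite mulr_ge0 //; apply: (le_trans (normr_ge0 (prob P set0 - prob Q set0))).
apply: ub_le_sup; last by exists set0 => //=.
exists 1 => _ [E mE <-]; rewrite ler_norml.
have := prob_ge0 P E; have := prob_ge0 Q E.
have := prob_le1 P mE; have := prob_le1 Q mE.
by move=> *; apply/andP; split; lra.
Qed.

Lemma tv_dist_gap P Q (e : R) : 0 < e -> 4 * e < tv_dist P Q ->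
  exists2 A, same_length A & e <= price P A - price Q A.
Proof.
move=> e0 etv; have : 2 * e < sup [set `|prob P E - prob Q E| | E in
             [set E : set (outcome_borel Y) | measurable E]].
  by move: etv; rewrite /tv_dist; lra.
move=> /sup_gt[]; first by exists `|prob P set0 - prob Q set0|, set0 => //=.
move=> _ [E0 mE0 <-] E0e.
have [E mE Ee] : exists2 E, measurable E & 2 * e < prob P E - prob Q E.
  have [E0P|E0N] := leP 0 (prob P E0 - prob Q E0).
    by exists E0 => //; rewrite -(ger0_norm E0P).
  (* Passing to the complement reverses the sign of the difference. *)
  exists (~` E0); first exact: measurableC.
  by rewrite !probC //; move: E0e; rewrite ltr0_norm //; lra.
(* A single [F] has to serve both measures, so [E] is approximated for their sum. The error [e / 2]
   under each of them reduces the gap from [2 * e] to [e]. *)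
have fin : (measure_add P Q setT < +oo)%E.
  by rewrite measure_addE lte_add_pinfty // -ge0_fin_numE // fin_num_measure.
have [_ /(_ (e / 2))[|F cF EF]] := approximable_measurable fin mE.
  by rewrite divr_gt0.
have mF := measurable_cylindrical cF.
have mD : measurable ((E `\` F) `|` (F `\` E)).
  by apply: measurableU; exact: measurableD.
have [A slA AF] := cylindrical_price cF; exists A => //; rewrite !AF.
have {}EF : (P ((E `\` F) `|` (F `\` E)) +
    Q ((E `\` F) `|` (F `\` E)) < (e / 2)%:E)%E by rewrite -measure_addE.
have PEF : prob P E <= prob P F + e / 2.
  apply: prob_sub_symD => //; apply: le_lt_trans EF; exact: leeDl.
have QFE : prob Q F <= prob Q E + e / 2.
  apply: prob_sub_symD => //; apply: le_lt_trans EF; rewrite setUC.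
  exact: leeDr.
lra.
Qed.

End price.

(** * Inequalities for a single round *)

Section arithmetic.
Context {F : realFieldType}.

Lemma growth_itv (e p v : F) (b : bool) : 0 < e -> e <= 1 ->
  0 <= p <= 1 -> 0 <= v <= 1 ->
  3 / 4 <= 1 + (if b then -1 else 1) * (e / 4) * (p - v) <= 5 / 4.
Proof.
move=> e0 e1 /andP[p0 p1] /andP[v0 v1].
have : 0 <= e * (1 + (p - v)) by apply: mulr_ge0; lra.
have : 0 <= e * (1 - (p - v)) by apply: mulr_ge0; lra.
by case: b => h1 h2; apply/andP; split; lra.
Qed.

(** With [u] and [v] the price moves in favour of Sceptic, the product is
    [(1 + (e / 4) * u) * (1 + (e / 4) * v)]. Here [u + v >= e / 2] contributes [2 * (e / 4) ^+ 2],
    and [u * v >= -1] takes back at most half of it. *)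
Lemma growth_product (e pt pf vt vf : F) : 0 < e ->
  0 <= pt <= 1 -> 0 <= pf <= 1 -> 0 <= vt <= 1 -> 0 <= vf <= 1 ->
  pt - pf <= e / 2 -> e <= vt - vf ->
  1 + (e / 4) ^+ 2 <=
  (1 + -1 * (e / 4) * (pt - vt)) * (1 + 1 * (e / 4) * (pf - vf)).
Proof.
move=> e0 /andP[pt0 pt1] /andP[pf0 pf1] /andP[vt0 vt1] /andP[vf0 vf1] gX ev.
pose u := vt - pt; pose v := pf - vf.
have uv : 0 <= (u + v) - e / 2 by rewrite /u /v; lra.
(* The sum of the two products below is [2 * (1 + u * v)]. *)
have uvN : 0 <= 1 + u * v.
  have : 0 <= (1 + u) * (1 + v) by apply: mulr_ge0; rewrite /u /v; lra.
  have : 0 <= (1 - u) * (1 - v) by apply: mulr_ge0; rewrite /u /v; lra.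
  lra.
have -> : (1 + -1 * (e / 4) * (pt - vt)) * (1 + 1 * (e / 4) * (pf - vf)) =
    1 + (e / 4) ^+ 2 + (e / 4) * ((u + v) - e / 2) +
    (e / 4) ^+ 2 * (1 + u * v).
  by rewrite /u /v; field.
have : 0 <= (e / 4) ^+ 2 * (1 + u * v) by rewrite mulr_ge0 ?sqr_ge0.
have : 0 <= (e / 4) * (u + v - e / 2) by rewrite mulr_ge0 //; lra.
lra.
Qed.

(** The boolean, read as 0 or 1, is the amount put aside. Before settlement the wealth is at most
    [5 / 2], so one saving brings it below 2, and at least 1 is left. *)
Lemma settle_itv (w g : F) : 0 < w <= 2 -> 3 / 4 <= g <= 5 / 4 ->
  0 < w * g - (2 <= w * g)%R%:R <= 2.
Proof.
move=> /andP[w0 w2] /andP[g1 g2].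
have wg0 : 0 < w * g by apply: mulr_gt0; lra.
have wg3 : w * g <= 5 / 2.
  have : 0 <= w * (5 / 4 - g) by apply: mulr_ge0; lra.
  lra.
by case: (leP 2 (w * g)) => wg /=; apply/andP; split; lra.
Qed.

(* Saving [1] out of at least [2] at most halves the wealth. *)
Lemma settle_potential (x : F) (n : nat) : 0 < x ->
  0 <= x * 2 ^+ n <= (x - (2 <= x)%R%:R) * 2 ^+ (n + (2 <= x)%R).
Proof.
move=> x0; have p0 : 0 < (2 : F) ^+ n by rewrite exprn_gt0.
rewrite mulr_ge0 ?(ltW x0) ?(ltW p0) //=.
case: (leP 2 x) => x2 /=; last by rewrite subr0 addn0.
by rewrite addn1 exprS mulrA ler_pM2r //; lra.
Qed.

(** One step of Bernoulli's inequality: [(1 + r * d) * (1 + d)] exceeds the bound by [r * d * d]. *)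
Lemma potential_round (r d W g : F) : 0 <= r -> 0 <= d ->
  1 + r * d <= W -> 1 + d <= g -> 1 + (r + 1) * d <= W * g.
Proof.
move=> r0 d0 rW dg; have rd : 0 <= r * d by rewrite mulr_ge0.
apply: le_trans (ler_pM _ _ rW dg); [|lra|lra].
have : 0 <= r * d * d by rewrite mulr_ge0.
lra.
Qed.

End arithmetic.

(** * The strategy of a single fund and its rounds *)

Section fund.
Context {R : realType} {Y : pointedType}.
Local Notation test := {fset nonempty_seq Y}.
Local Notation forecasts := (forecast R Y * forecast R Y)%type.
Implicit Types (X : forecasts) (A : test) (b : bool).

Definition forecast_of X b : forecast R Y := if b then X.1 else X.2.

Definition gap X A : R := price X.1 A - price X.2 A.

(* [true] is the side of Forecaster I. While a round is open Sceptic is short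
   of [target] on this side and long on the other one, [entry] being the prices
   at which the round was opened; [target = fset0] means that no round is open.
   [wealth] is the capital at risk at the opening of the round. *)
Record state := State {
  target : test;
  entry : bool -> R;
  wealth : bool -> R;
  saved : bool -> nat;
  rounds : nat }.

Variable e : R.
Implicit Types (s : state).

Definition init_state : state := State fset0 (fun=> 0) (fun=> 1) (fun=> 0%N) 0.

Definition stake_rate b : R := (if b then -1 else 1) * (e / 4).

(** The number of units held is fixed at the opening of a round, so the wealth is affine in the
    current price. *)
Definition growth s X b : R :=
  1 + stake_rate b * (price (forecast_of X b) (target s) - entry s b).

Definition value s X b : R := (saved s b)%:R + wealth s b * growth s X b.

Definition close_round s X : state :=
  if (target s != fset0) && (gap X (target s) <= e / 2) then
    State fset0 (fun=> 0)
      (fun b => let w := wealth s b * growth s X b in w - (2 <= w)%R%:R)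
      (fun b => (saved s b + (2 <= wealth s b * growth s X b)%R)%N)
      (rounds s).+1
  else s.

Definition gap_test X A : Prop := same_length A /\ e <= gap X A.

(** The default [fset0] of [xget] keeps the fund idle when no test has gap [e]. For positive [e] a
    test that is found differs from [fset0], whose gap is 0. *)
Definition open_round s X : state :=
  if target s == fset0 then
    let A := xget fset0 (gap_test X) in
    State A (fun b => price (forecast_of X b) A) (wealth s) (saved s) (rounds s)
  else s.

Definition step s X : state := open_round (close_round s X) X.

Definition run (h : seq forecasts) : state := foldl step init_state h.

Lemma run_rcons h X : run (rcons h X) = step (run h) X.
Proof. by rewrite /run foldl_rcons. Qed.

Hypotheses (e0 : 0 < e) (e1 : e <= 1).

(** The potential [wealth * 2 ^+ saved] of a side does not drop when 1 is put aside. By [inv_rounds]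
    the product of the two potentials grows at least linearly in the number of rounds. *)
Record invariant s : Prop := Invariant {
  inv_length : same_length (target s);
  inv_entry : forall b, 0 <= entry s b <= 1;
  inv_idle : target s = fset0 -> forall b, entry s b = 0;
  inv_gap : target s != fset0 -> e <= entry s true - entry s false;
  inv_wealth : forall b, 0 < wealth s b <= 2;
  inv_rounds : 1 + (rounds s)%:R * (e / 4) ^+ 2 <=
    (wealth s true * 2 ^+ saved s true) *
    (wealth s false * 2 ^+ saved s false) }.

Lemma invariant_init : invariant init_state.
Proof.
split => //=; first by exists 0%N => x; rewrite in_fset0.
- by move=> b; rewrite lexx ler01.
- by move=> b; rewrite ltr01 ler1n.
- by rewrite mul0r addr0 expr0 !mulr1.
Qed.

Lemma price_itv X A b : same_length A -> 0 <= price (forecast_of X b) A <= 1.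
Proof. by move=> slA; rewrite price_ge0 price_le1. Qed.

Lemma growth_bounds s X b : invariant s -> 3 / 4 <= growth s X b <= 5 / 4.
Proof.
by case=> slA v01 _ _ _ _; apply: growth_itv => //; exact: price_itv.
Qed.

Lemma growth_gt0 s X b : invariant s -> 0 < growth s X b.
Proof.
by move=> /(growth_bounds X b)/andP[g _]; apply: lt_le_trans g; rewrite divr_gt0.
Qed.

Lemma growth_idle s X b : invariant s -> target s = fset0 -> growth s X b = 1.
Proof.
by move=> Is s0; rewrite /growth s0 price0 (inv_idle Is) // subrr mulr0 addr0.
Qed.

Lemma value_ge_saved s X b : invariant s -> (saved s b)%:R <= value s X b.
Proof.
move=> Is; have /andP[w0 _] := inv_wealth Is b.
by rewrite lerDl mulr_ge0 ?(ltW w0) // ltW // growth_gt0.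
Qed.

Lemma growth_round s X : invariant s ->
  target s != fset0 -> gap X (target s) <= e / 2 ->
  1 + (e / 4) ^+ 2 <= growth s X true * growth s X false.
Proof.
move=> [slA v01 _ v_gap _ _] sN0 gX; apply: growth_product => //.
- exact: (price_itv X true).
- exact: (price_itv X false).
- exact: v_gap.
Qed.

Lemma invariant_close s X : invariant s -> invariant (close_round s X).
Proof.
move=> Is; rewrite /close_round; case: ifPn => // /andP[sN0 gX].
have g := growth_round Is sN0 gX.
split => //=; first by exists 0%N => x; rewrite in_fset0.
- by move=> b; rewrite lexx ler01.
- move=> b; apply: settle_itv; [exact: inv_wealth|exact: growth_bounds].
(* Settling lowers neither potential, so their product gains at least the factor from
   [growth_round]. *)
- have pot b := settle_potential (saved s b)
    (mulr_gt0 (proj1 (andP (inv_wealth Is b))) (growth_gt0 X b Is)).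
  have /andP[t0 t1] := pot true; have /andP[f0 f1] := pot false.
  apply: le_trans (ler_pM t0 f0 t1 f1).
  rewrite [leRHS](_ : _ = (wealth s true * 2 ^+ saved s true *
      (wealth s false * 2 ^+ saved s false)) *
      (growth s X true * growth s X false)); last by ring.
  by rewrite -natr1; apply: potential_round g; rewrite ?sqr_ge0 //; case: Is.
Qed.

Lemma invariant_open s X : invariant s -> invariant (open_round s X).
Proof.
move=> Is; rewrite /open_round; case: ifPn => // /eqP s0.
have slA : same_length (xget fset0 (gap_test X)).
  by case: xgetP => [A _ []//|_]; exists 0%N => x; rewrite in_fset0.
split => //=; [|..|exact: (inv_wealth Is)|exact: (inv_rounds Is)].
- by move=> b; rewrite price_ge0 price_le1.
- by move=> -> b; rewrite price0.
- by case: xgetP => [A _ []//|_] /eqP.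
Qed.

Lemma invariant_step s X : invariant s -> invariant (step s X).
Proof. by move=> Is; exact/invariant_open/invariant_close. Qed.

Lemma invariant_run h : invariant (run h).
Proof.
elim/last_ind: h => [|h X IH]; first exact: invariant_init.
by rewrite run_rcons; exact: invariant_step.
Qed.

(** The fund is self-financing: closing only moves money from [wealth] to [saved], and opening buys
    at the current prices. *)
Lemma value_step s X b : invariant s -> value (step s X) X b = value s X b.
Proof.
move=> Is; have Ic := invariant_close X Is.
transitivity (value (close_round s X) X b).
  rewrite /step /open_round; case: ifPn => // /eqP s0.
  by rewrite /value (growth_idle X b Ic s0) /growth /= subrr mulr0 addr0.
move: Ic; rewrite /close_round; case: ifP => // _ Ic.
rewrite /value (growth_idle X b Ic erefl) /= natrD; ring.
Qed.

Lemma step_saved s X b : (saved s b <= saved (step s X) b)%N.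
Proof.
apply: (@leq_trans (saved (close_round s X) b)).
  by rewrite /close_round; case: ifP => //= _; exact: leq_addr.
by rewrite /step /open_round; case: ifP.
Qed.

Lemma step_rounds s X : (rounds s <= rounds (step s X))%N.
Proof.
apply: (@leq_trans (rounds (close_round s X))).
  by rewrite /close_round; case: ifP => /=.
by rewrite /step /open_round; case: ifP.
Qed.

Lemma step_open s X : target s != fset0 -> rounds (step s X) = rounds s ->
  target (step s X) = target s /\ e / 2 < gap X (target s).
Proof.
move=> sN0; rewrite /step /close_round sN0 /=; case: leP => [_|gX _] /=.
  by rewrite /open_round => /eqP; rewrite gtn_eqF.
by rewrite /open_round (negbTE sN0).
Qed.

Lemma step_idle s X : target s = fset0 -> target (step s X) = fset0 ->
  ~ exists A, gap_test X A.
Proof.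
move=> s0; rewrite /step /close_round s0 eqxx /= /open_round s0 eqxx /=.
case: xgetP => [A _ [_ gA] A0|/forallNP //].
by move: gA; rewrite A0 /gap !price0 subrr leNgt e0.
Qed.

Section play.
Variable X : nat -> forecasts.
Local Notation s_ n := (run (mkseq X n)).

Lemma run_mkseqS n : s_ n.+1 = step (s_ n) (X n).
Proof. by rewrite mkseqS run_rcons. Qed.

Lemma run_saved_homo b : {homo (fun n => saved (s_ n) b) : m n / (m <= n)%N}.
Proof.
apply: homo_leq => // [m n p|n]; first exact: leq_trans.
by rewrite run_mkseqS step_saved.
Qed.

Lemma run_rounds_homo : {homo (fun n => rounds (s_ n)) : m n / (m <= n)%N}.
Proof.
apply: homo_leq => // [m n p|n]; first exact: leq_trans.
by rewrite run_mkseqS step_rounds.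
Qed.

(** If the number of rounds is bounded, it is constant from some [N] on. A round open after that
    would never close, keeping the gap of one fixed test above [e / 2] against the convergence to 0.
    Hence the fund stays idle, so no test is found. *)
Lemma rounds_unbounded_or_no_gap :
  (forall A, gap (X n) A @[n --> \oo] --> (0 : R)) ->
  (forall M, exists n, (M <= rounds (s_ n))%N) \/
  exists N, forall n, (N <= n)%N -> ~ exists A, gap_test (X n) A.
Proof.
move=> X0; have [|/existsNP[M /forallNP bM]] :=
  pselect (forall M, exists n, (M <= rounds (s_ n))%N); [by left|right].
have [N NP] : exists N, forall n, (N <= n)%N -> rounds (s_ n) = rounds (s_ N).
  have ubr : exists N, forall n, (rounds (s_ n) <= rounds (s_ N))%N.
    have exr : exists r, `[< exists n, rounds (s_ n) = r >].
      by exists (rounds (s_ 0)); apply/asboolP; exists 0%N.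
    have ltM r : `[< exists n, rounds (s_ n) = r >] -> (r <= M)%N.
      by move=> /asboolP[n <-]; rewrite leqNgt; apply/negP => /ltnW; exact: bM.
    have [r /asboolP[N rN] rmax] := ex_maxnP exr ltM.
    by exists N => n; rewrite rN rmax //; apply/asboolP; exists n.
  have [N NP] := ubr; exists N => n Nn; apply/eqP; rewrite eqn_leq NP /=.
  exact: run_rounds_homo.
exists N => n Nn.
have idle m : (N <= m)%N -> target (s_ m) = fset0.
  move=> Nm; apply/eqP/negP => /negP mN0.
  have stay p : target (s_ (m + p)) = target (s_ m).
    elim: p => [|p IH]; first by rewrite addn0.
    rewrite addnS run_mkseqS.
    have [||-> //] := @step_open (s_ (m + p)) (X (m + p)).
    - by rewrite IH.
    - by rewrite -run_mkseqS !NP // -?addnS; lia.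
  have big p : e / 2 < gap (X (m + p)) (target (s_ m)).
    have [||_] := @step_open (s_ (m + p)) (X (m + p)).
    - by rewrite stay.
    - by rewrite -run_mkseqS !NP // -?addnS; lia.
    - by rewrite stay.
  have /cvgr0Pnorm_lt /(_ (e / 2)) := X0 (target (s_ m)).
  case; first by rewrite divr_gt0.
  move=> q _ /(_ (m + q)%N) /= /(_ (leq_addl _ _)).
  by move=> /(le_lt_trans (ler_norm _)); rewrite ltNge (ltW (big q)).
apply: (@step_idle (s_ n)); first exact: idle.
by rewrite -run_mkseqS idle // ltnW.
Qed.

(** Were the savings bounded on both sides, the product of potentials would stay below [C], as
    wealths are at most 2; enough rounds contradict [inv_rounds]. *)
Lemma saved_unbounded : (forall M, exists n, (M <= rounds (s_ n))%N) ->
  exists b, forall M, exists n, (M <= saved (s_ n) b)%N.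
Proof.
move=> rU; apply: contrapT => /forallNP noU.
have /existsNP[Mt /forallNP bt] := noU true.
have /existsNP[Mf /forallNP bf] := noU false.
have d0 : 0 < (e / 4) ^+ 2 by rewrite exprn_gt0 // divr_gt0.
pose C : R := (2 * 2 ^+ Mt) * (2 * 2 ^+ Mf).
have [n rn] := rU (Num.trunc (C / (e / 4) ^+ 2)).+1.
have := inv_rounds (invariant_run (mkseq X n)).
have bnd b M : ~ (M <= saved (s_ n) b)%N ->
    0 <= wealth (s_ n) b * 2 ^+ saved (s_ n) b <= 2 * 2 ^+ M.
  move=> /negP; rewrite -ltnNge => /ltnW sM.
  have /andP[w0 w2] := inv_wealth (invariant_run (mkseq X n)) b.
  rewrite mulr_ge0 ?(ltW w0) ?exprn_ge0 //=.
  by rewrite ler_pM ?(ltW w0) ?exprn_ge0 // ler_weXn2l // ler1n.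
have /andP[t0 t1] := bnd _ _ (bt n); have /andP[f0 f1] := bnd _ _ (bf n).
move=> /le_trans /(_ (ler_pM t0 f0 t1 f1)); rewrite -/C => Cge.
have Clt : C < (rounds (s_ n))%:R * (e / 4) ^+ 2.
  rewrite -ltr_pdivrMr //.
  apply: lt_le_trans (_ : (Num.trunc (C / (e / 4) ^+ 2)).+1%:R <= _).
    by rewrite truncnS_gt.
  by rewrite ler_nat.
by have := le_lt_trans Cge Clt; rewrite ltNge lerDr ler01.
Qed.

End play.
End fund.

(** * Several weighted tests combined into one portfolio *)

Section mixture.
Context {R : realType} {Y : pointedType}.
Local Notation forecasts := (forecast R Y * forecast R Y)%type.

Definition combine (n : nat) (c : nat -> R) (A : nat -> {fset nonempty_seq Y}) :
    portfolio R Y :=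
  [fsfun x in \big[fsetU/fset0]_(i < n) A i =>
    \sum_(i < n) c i * (x \in A i)%:R].

Lemma gain_combine n c A (P P' : forecast R Y) :
  gain (combine n c A) P P' =
  \sum_(i < n) c i * (price P' (A i) - price P (A i)).
Proof.
pose D := \big[fsetU/fset0]_(i < n) A i.
have DA (i : 'I_n) : (A i `<=` D)%fset by exact: bigfcup_sup.
(* Coefficients may cancel, so the support can be smaller than [D]; the added terms vanish. *)
rewrite /gain (big_fset_incl _ (B := D)); last 2 first.
- exact: finsupp_sub.
- by move=> x _; rewrite memNfinsupp => /eqP ->; rewrite mul0r.
rewrite big_seq_cond.
under eq_bigr => x /andP[xD _] do rewrite fsfunE xD mulr_suml.
rewrite -big_seq_cond exchange_big /=; apply: eq_bigr => i _.
rewrite /price -sumrB mulr_sumr -(big_fset_incl _ (DA i)) => [|x _ /negbTE ->].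
  by apply: eq_big_seq => x ->; rewrite mulr1.
by rewrite mulr0 mul0r.
Qed.

End mixture.

(** * The mixture of funds, its capital and the conclusion *)

Section sceptic.
Context {R : realType} {Y : pointedType}.
Local Notation forecasts := (forecast R Y * forecast R Y)%type.

Definition threshold (k : nat) : R := k.+1%:R^-1.

Lemma threshold_gt0 k : 0 < threshold k.
Proof. by rewrite invr_gt0. Qed.

Lemma threshold_le1 k : threshold k <= 1.
Proof. by rewrite invf_le1 // ler1n. Qed.

(** The weights sum to 1, and those of all funds with number above [n] sum to [weight n]. *)
Definition weight (k : nat) : R := 2 ^- k.+1.

Lemma weight_gt0 k : 0 < weight k.
Proof. by rewrite invr_gt0 exprn_gt0. Qed.

Lemma weight_half k : weight k = weight k.+1 + weight k.+1.
Proof. by rewrite {1}[weight k]splitr /weight (exprS _ k.+1) invfM mulrC. Qed.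

(* The fund number [k] starts at step [k], so that only finitely many funds are
   active at any time. *)
Definition fund k (h : seq forecasts) : state := run (threshold k) (drop k h).

Definition sceptic_side b (h : seq forecasts) : portfolio R Y :=
  combine (size h)
    (fun k => weight k * (stake_rate (threshold k) b * wealth (fund k h) b))
    (fun k => target (fund k h)).

Definition sceptic : strategy R Y :=
  fun h => (sceptic_side true h, sceptic_side false h).

Section play.
Variables P1 P2 : nat -> forecast R Y.

Definition play n : forecasts := (P1 n, P2 n).

Definition capital b n : R :=
  if b then capital1 sceptic P1 P2 n else capital2 sceptic P1 P2 n.

Lemma capital0 b : capital b 0 = 1.
Proof. by case: b. Qed.

Lemma capitalS b n : capital b n.+1 = capital b n +
  gain (sceptic_side b (mkseq play n.+1))
    (forecast_of (play n) b) (forecast_of (play n.+1) b).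
Proof. by case: b. Qed.

Lemma fund_early k n : (n <= k)%N -> fund k (mkseq play n) = init_state.
Proof. by move=> nk; rewrite /fund drop_oversize // size_mkseq. Qed.

Lemma fund_late k n :
  fund k (mkseq play (k + n)) =
  run (threshold k) (mkseq (fun i => play (k + i)) n).
Proof.
rewrite /fund /mkseq -map_drop drop_iota addKn add0n.
by rewrite -[in iota k n](addn0 k) iotaDl -map_comp.
Qed.

Lemma fund_step k n : (k <= n)%N ->
  fund k (mkseq play n.+1) =
  step (threshold k) (fund k (mkseq play n)) (play n).
Proof.
by move=> kn; rewrite /fund mkseqS drop_rcons ?size_mkseq // run_rcons.
Qed.

Lemma invariant_fund k h : invariant (threshold k) (fund k h).
Proof. exact: invariant_run (threshold_gt0 k) (threshold_le1 k) _. Qed.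

Definition fund_value k n b : R :=
  value (threshold k) (fund k (mkseq play n.+1)) (play n) b.

Lemma fund_value_start k b : fund_value k k b = 1.
Proof.
rewrite /fund_value fund_step // value_step ?threshold_gt0 ?threshold_le1 //;
  last exact: invariant_fund.
by rewrite fund_early // /value /growth /= price0 subrr mulr0 addr0 mul1r add0r.
Qed.

Lemma fund_valueS k n b : (k <= n)%N ->
  fund_value k n.+1 b = fund_value k n b +
    stake_rate (threshold k) b * wealth (fund k (mkseq play n.+1)) b *
    (price (forecast_of (play n.+1) b) (target (fund k (mkseq play n.+1))) -
     price (forecast_of (play n) b) (target (fund k (mkseq play n.+1)))).
Proof.
move=> kn; rewrite /fund_value fund_step ?(leqW kn) // value_step
  ?threshold_gt0 ?threshold_le1 //; last exact: invariant_fund.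
rewrite /value /growth; ring.
Qed.

(** The term [weight n] is the reserve for the funds not yet started. When fund [n.+1] starts with
    value 1, half of the reserve goes to it and half remains. *)
Lemma capitalE b n : capital b n =
  weight n + \sum_(k < n.+1) weight k * fund_value k n b.
Proof.
elim: n => [|n IH].
  rewrite capital0 big_ord1 fund_value_start /weight expr1 mulr1.
  by rewrite {1}[1]splitr mul1r.
rewrite capitalS gain_combine IH size_mkseq (weight_half n).
rewrite [in RHS]big_ord_recr /= fund_value_start mulr1.
have -> : \sum_(k < n.+1) weight k * fund_value k n.+1 b =
    \sum_(k < n.+1) weight k * fund_value k n b +
    \sum_(k < n.+1) weight k *
    (stake_rate (threshold k) b * wealth (fund k (mkseq play n.+1)) b) *
    (price (forecast_of (play n.+1) b) (target (fund k (mkseq play n.+1))) -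
     price (forecast_of (play n) b) (target (fund k (mkseq play n.+1)))).
  rewrite -big_split; apply: eq_bigr => k _ /=.
  by rewrite fund_valueS ?(leq_ord k) // mulrDr !mulrA.
by move: (\sum_(k < _) _) (\sum_(k < _) _) => x y; ring.
Qed.

Lemma fund_value_ge_saved k n b :
  (saved (fund k (mkseq play n.+1)) b)%:R <= fund_value k n b.
Proof.
exact: (value_ge_saved (threshold_gt0 k) (threshold_le1 k) _ _
  (invariant_fund _ _)).
Qed.

Lemma fund_value_ge0 k n b : 0 <= fund_value k n b.
Proof. exact: le_trans (fund_value_ge_saved k n b). Qed.

Lemma capital_ge_saved k n b : (k <= n)%N ->
  weight k * (saved (fund k (mkseq play n.+1)) b)%:R <= capital b n.
Proof.
move=> kn; rewrite capitalE (bigD1 (Ordinal (kn : (k < n.+1)%N))) //= addrCA.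
apply: ler_wpDr; last by rewrite ler_pM2l ?weight_gt0 ?fund_value_ge_saved.
rewrite addr_ge0 ?(ltW (weight_gt0 _)) // sumr_ge0 // => i _.
by rewrite mulr_ge0 ?(ltW (weight_gt0 _)) ?fund_value_ge0.
Qed.

Lemma capital_ge0 b n : 0 <= capital b n.
Proof.
apply: le_trans (capital_ge_saved b (leq0n n)).
by rewrite mulr_ge0 ?(ltW (weight_gt0 _)).
Qed.

(** Savings never decrease, so each lower bound reached persists at all later steps, since the other
    funds and the reserve are non-negative. *)
Lemma capital_pinfty k b :
  (forall M, exists n, (M <= saved (fund k (mkseq play (k + n))) b)%N) ->
  capital b n @[n --> \oo] --> +oo.
Proof.
move=> sU; apply/cvgryPge => B.
have [n Mn] := sU (Num.trunc (B / weight k)).+1.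
exists (k + n)%N => // m /= nm.
have km : (k <= m)%N by apply: leq_trans nm; exact: leq_addr.
apply: le_trans (capital_ge_saved b km).
rewrite mulrC -ler_pdivrMr ?weight_gt0 //.
apply: ltW; apply: (lt_le_trans (truncnS_gt _)).
rewrite ler_nat; apply: (leq_trans Mn).
rewrite fund_late -(subnKC (leqW nm)) -addnA fund_late.
by apply: run_saved_homo; exact: leq_addr.
Qed.

Lemma gap_cvg0 : merge_weakly P1 P2 ->
  forall A, gap (play n) A @[n --> \oo] --> (0 : R).
Proof.
move=> W A; have gE : (fun n => gap (play n) A) = fun n =>
    \sum_(x <- A)
      (prob (P1 n) (cylinder (val x)) - prob (P2 n) (cylinder (val x))).
  by apply/funext => n; rewrite sumrB.
have -> : (0 : R) = \sum_(x <- A) 0 by rewrite big1.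
by rewrite gE; apply: cvg_big => [|x _]; [exact: add_continuous|exact: W].
Qed.

(** Unboundedly many rounds of fund [k] would send one capital to infinity. Otherwise eventually no
    test has gap [threshold k], and [tv_dist_gap] bounds the distance. *)
Lemma fund_merge k : finite_set [set: Y] -> merge_weakly P1 P2 ->
  (forall b, ~ (capital b n @[n --> \oo] --> +oo)) ->
  exists N, forall n, (N <= n)%N -> tv_dist (P1 n) (P2 n) <= 4 * threshold k.
Proof.
move=> finY W ncap; pose X i := play (k + i).
have X0 A : gap (X n) A @[n --> \oo] --> (0 : R).
  by move: (gap_cvg0 W A); rewrite -(cvg_shiftn k); under eq_fun do rewrite addnC.
have [rU|[N NP]] :=
  rounds_unbounded_or_no_gap (threshold_gt0 k) (threshold_le1 k) X0.
  have [b sU] := saved_unbounded (threshold_gt0 k) (threshold_le1 k) rU.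
  exfalso; apply: (ncap b); apply: (@capital_pinfty k).
  by move=> M; have [n Mn] := sU M; exists n; rewrite fund_late.
exists (k + N)%N => n Nn; rewrite leNgt; apply/negP.
move=> /(tv_dist_gap finY (threshold_gt0 k))[A slA gA].
apply: (NP (n - k)%N); first lia.
by exists A; split; rewrite // /X subnKC //; lia.
Qed.

End play.
End sceptic.

Theorem theorem9 (R : realType) (Y : pointedType) (hY : finite_set [set: Y]) :
  exists S : strategy R Y, forall P1 P2 : nat -> forecast R Y,
    (forall n : nat, 0 <= capital1 S P1 P2 n /\ 0 <= capital2 S P1 P2 n) /\
    (merge_weakly P1 P2 ->
     ~ (capital1 S P1 P2 n @[n --> \oo] --> +oo) ->
     ~ (capital2 S P1 P2 n @[n --> \oo] --> +oo) ->
     tv_dist (P1 n) (P2 n) @[n --> \oo] --> (0 : R)).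
Proof.
exists sceptic => P1 P2; split.
  move=> n.
  by split; [exact: (capital_ge0 P1 P2 true)|exact: (capital_ge0 P1 P2 false)].
move=> W n1 n2; apply/cvgr0Pnorm_le => e e0.
have ncap b : ~ (capital P1 P2 b n @[n --> \oo] --> +oo) by case: b.
(* Then [k.+1 > 4 / e], that is, [4 * threshold k < e]. *)
pose k := Num.trunc (4 / e).
have [N NP] := fund_merge k hY W ncap; exists N => // n /= /NP tvk.
rewrite ger0_norm ?tv_dist_ge0 //; apply: le_trans tvk _.
by rewrite ler_pdivrMr // mulrC -ler_pdivrMr // ltW // truncnS_gt.
Qed.
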